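(* Let $r,n,s,f,A$ be integers with $n>0$, $r\geq 0$ and $f(r-s)\equiv 0\bmod n$, and let $G$ be the cyclically presented group in class $\mathfrak{M}$ determined by $(r,n,s,f,A)$. Suppose that $(r,s)=(n,A)=1$ and that $\mu=|r^n-s^n|\neq 0$. Then $G$ is the finite metacyclic group \[G\cong B\left(\frac{(n,f)(r^n-s^n)}{n},\ \frac{n}{(n,f)},\ (s\hat{r})^{f\bar{A}},\ 1\right)\] of order $|r^n-s^n|$, where $r\hat{r}\equiv 1\bmod |r^n-s^n|$ and $A\bar{A}\equiv 1\bmod n$.
   Context: $(a,b)$ denotes the greatest common divisor, with $(n,0)=n$. For a word $w$ in $x_0,\dots,x_{n-1}$, $G_n(w)=\langle x_0,\dots,x_{n-1}\mid w,\theta(w),\dots,\theta^{n-1}(w)\rangle$ where $\theta(x_i)=x_{i+1}$, subscripts modulo $n$. The cyclically presented group in class $\mathfrak{M}$ determined by $(r,n,s,f,A)$ (with $n>0$, $r\ge 0$, $f(r-s)\equiv 0\bmod n$) is $G=G_n(w)$ where $w=\prod_{i=0}^{r-1}x_{if}\left(\prod_{i=0}^{s-1}x_{A+if}\right)^{-1}$ if $s\geq 0$ and $w=\prod_{i=0}^{r-1}x_{if}\prod_{i=0}^{|s|-1}x_{A+(r+i)f}$ if $s\leq 0$. Equivalently, $G$ is the kernel of the retraction $\nu^f:E\to\langle t\rangle\cong\mathbb{Z}_n$, $\nu^f(t)=t$, $\nu^f(y)=t^f$, where $E=\langle t,y\mid t^n,\ y^rt^Ay^{-s}t^{-A}\rangle$.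 A group is metacyclic if it has a cyclic normal subgroup with cyclic quotient. For integers $M,N,R,\lambda$ with $R^N\equiv 1\bmod M$, $B(M,N,R,\lambda)=\langle a,b\mid a^M=1,\ bab^{-1}=a^R,\ b^N=a^{\lambda M/(M,R-1)}\rangle$. The parameter $R$ matters only modulo $M$; since $s\hat r$ is a unit modulo $|r^n-s^n|$, its powers with possibly negative exponents are read modulo $|r^n-s^n|$. *)

(* Defs.v *)
(* Words are compared modulo relators by the classical decision of boolp, so
   that every presentation, solvable word problem or not, yields a groupType. *)
From HB Require Import structures.
From mathcomp Require Import all_boot all_order all_algebra all_fingroup.
From mathcomp Require Import boolp classical_sets.

Set Implicit Arguments.
Unset Strict Implicit.
Unset Printing Implicit Defensive.

Import GRing.Theory.

Local Open Scope classical_set_scope.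
Local Open Scope quotient_scope.

Local Notation quot_repr := generic_quotient.repr.

Section Words.
Variable X : Type.

(* The letter (x, false) stands for x and (x, true) for x^-1. *)
Definition word := seq (X * bool).

Definition letter (x : X) : word := [:: (x, false)].

Definition word_inv (w : word) : word := rev [seq (l.1, ~~ l.2) | l <- w].

Definition word_expz (w : word) (k : int) : word :=
  match k with
  | Posz m => flatten (nseq m w)
  | Negz m => flatten (nseq m.+1 (word_inv w))
  end.

(* The relator expressing the relation u = v. *)
Definition relation (u v : word) : word := u ++ word_inv v.

End Words.

Section Presentation.
Variables (X : choiceType) (rels : set (word X)).

Inductive pres_cong : word X -> word X -> Prop :=
| pres_refl u : pres_cong u u
| pres_sym u v : pres_cong u v -> pres_cong v u
| pres_trans u v w : pres_cong u v -> pres_cong v w -> pres_cong u w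
| pres_cat u u' v v' :
    pres_cong u u' -> pres_cong v v' -> pres_cong (u ++ v) (u' ++ v')
| pres_cancel x b : pres_cong [:: (x, b); (x, ~~ b)] [::]
| pres_rel w : rels w -> pres_cong w [::].

Definition pres_rel_bool (u v : seq (X * bool)) : bool := `[< pres_cong u v >].

Lemma pres_rel_bool_equiv : equiv_class_of pres_rel_bool.
Proof.
split=> [u|u v|v u w].
- by apply/asboolP; exact: pres_refl.
- by apply/asboolP/asboolP; exact: pres_sym.
- by move=> /asboolP uv /asboolP vw; apply/asboolP; exact: pres_trans uv vw.
Qed.

Canonical pres_equiv := EquivRelPack pres_rel_bool_equiv.

(* The group < X | rels >. *)
Definition presented := {eq_quot pres_equiv}.

HB.instance Definition _ := EqQuotient.on presented.
HB.instance Definition _ := Choice.on presented.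

Definition pres_class (u : word X) : presented := \pi_presented u.

Lemma pres_classP (u v : word X) : pres_class u = pres_class v <-> pres_cong u v.
Proof. by split=> [/eqmodP/asboolP | uv]; last exact/eqmodP/asboolP. Qed.

Lemma pres_classK (g : presented) : pres_class (quot_repr g) = g.
Proof. exact: reprK. Qed.

Lemma repr_pres_class (u : word X) : pres_cong (quot_repr (pres_class u)) u.
Proof. by apply/pres_classP; rewrite pres_classK. Qed.

Lemma pres_cancel_inv (u : word X) : pres_cong (u ++ word_inv u) [::].
Proof.
elim: u => [|[x b] u IHu]; first exact: pres_refl.
rewrite /word_inv /= rev_cons -cats1 -cat_cons catA -/(word_inv u).
apply: (pres_trans _ (pres_cancel x b)); rewrite -(cat1s _ u) -!catA.
rewrite -[[:: (x, b); _]]cat1s; apply: pres_cat; first exact: pres_refl.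
by rewrite catA; apply: (pres_cat IHu); exact: pres_refl.
Qed.

Lemma word_invK : involutive (@word_inv X).
Proof.
move=> u; rewrite /word_inv map_rev revK -map_comp -[RHS]map_id.
by apply: eq_map => -[x b] /=; rewrite negbK.
Qed.

Definition pres_one : presented := pres_class [::].
Definition pres_mul (g h : presented) : presented :=
  pres_class (quot_repr g ++ quot_repr h).
Definition pres_inv (g : presented) : presented :=
  pres_class (word_inv (quot_repr g)).

Lemma pres_mulE (u v : word X) :
  pres_mul (pres_class u) (pres_class v) = pres_class (u ++ v).
Proof. by apply/pres_classP; apply: pres_cat; exact: repr_pres_class. Qed.

Lemma pres_mulA : associative pres_mul.
Proof.
move=> g h k; rewrite -(pres_classK g) -(pres_classK h) -(pres_classK k).
by rewrite !pres_mulE catA.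
Qed.

Lemma pres_mul1 : left_id pres_one pres_mul.
Proof. by move=> g; rewrite -(pres_classK g) pres_mulE. Qed.

Lemma pres_mulr1 : right_id pres_one pres_mul.
Proof. by move=> g; rewrite -(pres_classK g) pres_mulE cats0. Qed.

Lemma pres_mulV : left_inverse pres_one pres_inv pres_mul.
Proof.
move=> g; rewrite -{2}(pres_classK g) pres_mulE; apply/pres_classP.
by rewrite -{2}(word_invK (quot_repr g)); exact: pres_cancel_inv.
Qed.

Lemma pres_mulrV : right_inverse pres_one pres_inv pres_mul.
Proof.
move=> g; rewrite -{1}(pres_classK g) pres_mulE; apply/pres_classP.
exact: pres_cancel_inv.
Qed.

HB.instance Definition _ := isGroup.Build presented
  pres_mulA pres_mul1 pres_mulr1 pres_mulV pres_mulrV.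

End Presentation.

Definition isomorphic (G H : groupType) : Prop :=
  exists phi : {multiplicative G -> H}, bijective phi.

Local Open Scope ring_scope.

Lemma modz_ltn (n : nat) (z : int) : (0 < n)%N -> (`|(z %% n)%Z| < n)%N.
Proof.
move=> n_gt0; rewrite -ltz_nat gez0_abs ?modz_ge0 ?ltz_pmod //.
by rewrite -lt0n.
Qed.

Section CyclicallyPresented.
Variables (n : nat) (n_gt0 : (0 < n)%N).

(* The generator x_z, with its subscript read modulo n. *)
Definition genz (z : int) : word 'I_n := letter (Ordinal (modz_ltn z n_gt0)).

(* theta : x_i |-> x_(i+1) *)
Definition shift (w : word 'I_n) : word 'I_n := [seq (ordS l.1, l.2) | l <- w].

Definition cyc_presented (w : word 'I_n) : groupType :=
  presented [set iter j shift w | j in [set j : nat | (j < n)%N]].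

Definition classM_relator (r : nat) (s f A : int) : word 'I_n :=
  \big[cat/[::]]_(0 <= i < r) genz (i%:Z * f) ++
  (if 0 <= s then word_inv (\big[cat/[::]]_(0 <= i < `|s|%N) genz (A + i%:Z * f))
   else \big[cat/[::]]_(0 <= i < `|s|%N) genz (A + (r%:Z + i%:Z) * f)).

Definition classM_group (r : nat) (s f A : int) : groupType :=
  cyc_presented (classM_relator r s f A).

End CyclicallyPresented.

(* The generators a and b are the letters false and true.  The sign that gcdz
   fixes in gcdz M (R - 1) is immaterial: replacing a by a^-1 changes the sign
   of the last exponent. *)
Definition groupB (M N R lam : int) : groupType :=
  let a := letter false in
  let b := letter true in
  presented [set word_expz a M;
                 relation (b ++ a ++ word_inv b) (word_expz a R);
                 relation (word_expz b N)
                   (word_expz a (lam * M %/ gcdz M (R - 1))%Z)].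

(* An integer representing u ^ k modulo m, for u a unit modulo m: the first
   Bezout coefficient of (u, m) represents the inverse of u. *)
Definition expz_mod (m u k : int) : int :=
  match k with
  | Posz e => u ^+ e
  | Negz e => (egcdz u m).1 ^+ e.+1
  end.

Lemma expz_modN (m u : int) (e : nat) : coprimez u m ->
  (expz_mod m u (- e%:Z) * u ^+ e = 1 %[mod m])%Z.
Proof.
move=> /eqP cum; case: e => [|e]; first by rewrite oppr0 /= !expr0 mulr1.
rewrite -NegzE /=; case: egcdzP => x y xy _ /=.
have xu1 : (x * u = 1 %[mod m])%Z.
  by rewrite -cum -xy [(x * u + _)%R]addrC modzMDl.
by rewrite -exprMn -(modzXm _ (x * u)) xu1 modzXm expr1n.
Qed.

(* Main.v *)
From Corelib Require Import Setoid Morphisms.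
Require Import Defs.
From mathcomp Require Import all_boot all_order all_algebra all_fingroup.
From mathcomp Require Import cyclic.
From mathcomp Require classical_sets.
From HB Require Import structures.
From mathcomp Require Import ring zify.

(** Put D = r^n - s^n and Q = s rhat, so that Q^n = 1 modulo D, and let t be
    the generator of Z_n acting on G by theta.  In the semidirect product of G
    and <t> the element y = x_0 t^f satisfies

      x_i x_(i+f) ... x_(i+(k-1)f) = t^i y^k t^(-kf) t^(-i),

    and the relators of G become y^r = t^A y^s t^(-A).  Applying this relation
    n times gives y^(r^n) = y^(s^n), that is y^D = 1; since r is then
    invertible in the exponents, t^(-A) y t^A = y^Q.  Hence every element of G
    is one of the y^k t^(-kf), and these multiply by

      k . l = k + Q^(k f Abar) l    modulo D.

    Both presentations are identified with this law on Z/D, a finite group of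
    order |D|.

    For G, the semidirect product is avoided by working with the left-hand
    sides of the first display, the runs: they form a cocycle in k, by which
    every run is shown to have period D and to equal a run starting at x_0
    ([run_from0]).  So k |-> run from 0 of length k maps Z/D onto G, and it is
    inverse to the morphism x_i |-> Q^(-i Abar) ([classM_twisted]).

    For B(M, N, R, 1), write d = (n, f), N = n / d and D = N M.  The multiples
    of N form a cyclic normal subgroup of Z/D of order |M| with quotient
    generated by b = 1, and conjugation by b is multiplication by
    R = Q^(f Abar).  Here b^N = 1 + R + ... + R^(N-1), and it has to be a
    unit times N M / (M, R - 1).  Now R and Q^d generate the same group of
    units, so (M, R - 1) is |T| with T = r^d - s^d, and the sum is a
    rearrangement of 1 + Q^d + ... + Q^(d(N-1)), which is
    rhat^(d(N-1)) D / T.  As N M = D, the unit is rhat^(d(N-1)) up to sign;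
    multiplying N by it gives the generator a of the normal subgroup
    ([classM_groupB]).  Conversely every element of B is a^i b^j, and only the
    trivial one goes to 0 ([groupB_twisted]). *)

Set Implicit Arguments.
Unset Strict Implicit.
Unset Printing Implicit Defensive.

Import GRing.Theory Num.Theory.

Local Open Scope ring_scope.

(** * Congruences between integers and powers of a unit *)

(** Named, so that setoid rewriting applies to congruences. *)
Definition eqm (m x y : int) : Prop := (x = y %[mod m])%Z.

Lemma eqm_dvd m x y : eqm m x y <-> (m %| x - y)%Z.
Proof. by rewrite /eqm -eqz_mod_dvd; split=> [->|/eqP]. Qed.

#[local] Instance eqm_equiv m : Equivalence (eqm m).
Proof. by split=> [x|x y|x y z]; rewrite /eqm // => -> ->. Qed.

#[local] Instance eqm_add m :
  Proper (eqm m ==> eqm m ==> eqm m) (@GRing.add int).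
Proof.
by move=> x x' xx' y y' yy'; rewrite /eqm -(modzDm x) xx' yy' modzDm.
Qed.

#[local] Instance eqm_opp m : Proper (eqm m ==> eqm m) (@GRing.opp int).
Proof. by move=> x x' xx'; rewrite /eqm -(modzNm x) xx' modzNm. Qed.

#[local] Instance eqm_mul m :
  Proper (eqm m ==> eqm m ==> eqm m) (@GRing.mul int).
Proof.
by move=> x x' xx' y y' yy'; rewrite /eqm -(modzMm x) xx' yy' modzMm.
Qed.

#[local] Instance eqm_exp m : Proper (eqm m ==> eq ==> eqm m) (@GRing.exp int).
Proof. by move=> x x' xx' p _ <-; rewrite /eqm -(modzXm p x) xx' modzXm. Qed.

Lemma eqm_sum m (I : Type) (s : seq I) (u v : I -> int) :
    (forall i, eqm m (u i) (v i)) ->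
  eqm m (\sum_(i <- s) u i) (\sum_(i <- s) v i).
Proof.
move=> uv; elim/big_ind2: _ => // x x' y y' xx' yy'.
by rewrite xx' yy'.
Qed.

Lemma eqm_dvdl m' m x y : (m' %| m)%Z -> eqm m x y -> eqm m' x y.
Proof. by move=> m'm /eqm_dvd/(dvdz_trans m'm)/eqm_dvd. Qed.

Lemma eqm_MDl m q x : eqm m (q * m + x) x.
Proof. exact: modzMDl. Qed.

Lemma eqm_modz m x : eqm m (x %% m)%Z x.
Proof. exact: modz_mod. Qed.

Lemma eqm_abs m x y : eqm `|m|%N%:Z x y <-> eqm m x y.
Proof. by rewrite !eqm_dvd !dvdzE; case: m. Qed.

Lemma eqm0 m x : eqm m x 0 <-> (m %| x)%Z.
Proof. by rewrite eqm_dvd subr0. Qed.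

Section CyclicPower.
Variables (m : int) (n : nat) (Q : int).
Hypotheses (n_gt0 : (0 < n)%N) (Qn1 : eqm m (Q ^+ n) 1).

(** When Q^n = 1 modulo m this represents Q^z for every integer z, without
    an inverse of Q.  It depends on z modulo n as an integer, not only modulo
    m, which is what allows it to be nested in exponents. *)
Definition cpow (n : nat) (Q z : int) : int := Q ^+ `|(z %% n)%Z|.

Lemma eq_cpow z w : eqm n z w -> cpow n Q z = cpow n Q w.
Proof. by rewrite /cpow => ->. Qed.

Lemma cpow0 : cpow n Q 0 = 1.
Proof. by rewrite /cpow mod0z. Qed.

Lemma cpow_nat (k : nat) : eqm m (cpow n Q k) (Q ^+ k).
Proof.
rewrite /cpow modz_nat /= {2}(divn_eq k n) exprD mulnC exprM Qn1 expr1n.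
by rewrite mul1r.
Qed.

Lemma cpowD z w : eqm m (cpow n Q (z + w)) (cpow n Q z * cpow n Q w).
Proof.
have n0 : n%:Z != 0 by rewrite -lt0n.
rewrite /(cpow _ _ z) /(cpow _ _ w) -exprD -cpow_nat PoszD.
rewrite !gez0_abs ?modz_ge0 //.
rewrite (@eq_cpow (z + w) ((z %% n)%Z + (w %% n)%Z)); first reflexivity.
by rewrite !eqm_modz.
Qed.

Lemma cpowMn (z : int) (k : nat) :
  eqm m (cpow n Q (z * k%:Z)) (cpow n Q z ^+ k).
Proof.
elim: k => [|k IH]; first by rewrite mulr0 cpow0.
by rewrite intS mulrDr mulr1 cpowD IH exprS.
Qed.

Lemma cpowN z : eqm m (cpow n Q z * cpow n Q (- z)) 1.
Proof. by rewrite -cpowD subrr cpow0. Qed.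

Lemma expz_mod_cpow z : coprimez Q m -> eqm m (expz_mod m Q z) (cpow n Q z).
Proof.
move=> coQm; case: z => k; first by rewrite cpow_nat.
have Qk : eqm m (expz_mod m Q (- k.+1%:Z) * Q ^+ k.+1) 1 by exact: expz_modN.
rewrite NegzE -[expz_mod _ _ _]mulr1 -(cpowN k.+1) cpow_nat mulrA Qk.
by rewrite mul1r.
Qed.

End CyclicPower.

(** * Integer powers and presented groups *)

(** One induction step, read both ways, serves both signs; in groups the
    converse direction is cancellation. *)
Lemma int_ind_iff (P : int -> Prop) :
  P 0 -> (forall k, P k <-> P (k + 1)) -> forall k, P k.
Proof.
move=> P0 PS; elim/int_rect => // k Pk; first by rewrite -addn1 PoszD -PS.
by rewrite PS -addn1 PoszD opprD subrK.
Qed.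

Section IntegerPowers.
Local Open Scope group_scope.
Variables (H : groupType) (g : H).

Definition expgz (k : int) : H :=
  match k with Posz m => g ^+ m | Negz m => g ^- m.+1 end.

Lemma expgzS k : expgz (k + 1)%R = expgz k * g.
Proof.
case: k => m; first by rewrite -PoszD addn1 /= expgSr.
have -> : (Negz m + 1)%R = (- m%:Z)%R by rewrite NegzE; lia.
by case: m => [|m]; rewrite /= ?expg1 ?mulVg // (expgS _ m.+1) invgM mulgVK.
Qed.

Lemma expgz_uniq (p : int -> H) : p 0%R = 1 ->
  (forall k, p (k + 1)%R = p k * g) -> forall k, p k = expgz k.
Proof.
move=> p0 pS; apply: int_ind_iff => // k.
by rewrite pS expgzS; split=> [->|/mulIg].
Qed.

Lemma expgzD k l : expgz (k + l)%R = expgz k * expgz l.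
Proof.
elim/int_ind_iff: l => [|l]; first by rewrite addr0 mulg1.
by rewrite addrA !expgzS mulgA; split=> [->|/mulIg].
Qed.

Lemma expgz1 : expgz 1 = g. Proof. exact: expg1. Qed.

Lemma expgzN k : expgz (- k)%R = (expgz k)^-1.
Proof. by apply: (mulgI (expgz k)); rewrite -expgzD subrr mulgV. Qed.

End IntegerPowers.

Lemma expgzM (H : groupType) (g : H) k l :
  expgz g (k * l) = expgz (expgz g k) l.
Proof.
apply: (expgz_uniq (p := fun l => expgz g (k * l))) => [|{}l].
  by rewrite mulr0.
by rewrite mulrDr mulr1 expgzD.
Qed.

Lemma morph_expgz (H H' : groupType) (phi : H -> H') g k : phi 1%g = 1%g ->
  {morph phi : x y / (x * y)%g} -> phi (expgz g k) = expgz (phi g) k.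
Proof.
move=> phi1 phiM; apply: (expgz_uniq (p := fun k => phi (expgz g k))) => // l.
by rewrite expgzS phiM.
Qed.

Section Evaluation.
Local Open Scope group_scope.
Variables (X : choiceType) (H : groupType).

Definition eval (h : X -> H) (w : word X) : H :=
  \prod_(l <- w) (if l.2 then (h l.1)^-1 else h l.1).

Lemma eval_cat h u v : eval h (u ++ v) = eval h u * eval h v.
Proof. exact: big_cat. Qed.

Lemma eval_letter h x : eval h (letter x) = h x.
Proof. exact: big_seq1. Qed.

Lemma eval_inv h w : eval h (word_inv w) = (eval h w)^-1.
Proof.
elim: w => [|[x b] w IHw]; first by rewrite /eval !big_nil invg1.
rewrite /word_inv /= rev_cons -cats1 eval_cat -/(word_inv w) IHw.
rewrite /eval !big_cons big_nil mulg1 invgM /=.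
by case: b => /=; rewrite ?invgK.
Qed.

Lemma eval_relation h u v :
  eval h u = eval h v -> eval h (relation u v) = 1.
Proof. by move=> uv; rewrite eval_cat eval_inv uv mulgV. Qed.

Lemma eval_bigcat h m (F : nat -> word X) :
  eval h (\big[cat/[::]]_(0 <= i < m) F i) = \prod_(0 <= i < m) eval h (F i).
Proof.
apply: (big_morph (eval h)); first exact: eval_cat.
by rewrite /eval big_nil.
Qed.

Lemma eval_expz h w k : eval h (word_expz w k) = expgz (eval h w) k.
Proof.
have pos v (m : nat) : eval h (flatten (nseq m v)) = eval h v ^+ m.
  elim: m => [|m IHm]; first by rewrite /eval big_nil.
  by rewrite /= eval_cat IHm expgS.
by case: k => m; rewrite /word_expz pos // eval_inv expVgn.
Qed.

Variable rels : classical_sets.set (word X).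

Lemma eval_pres_cong h :
    (forall w, rels w -> eval h w = 1) ->
  forall u v, pres_cong rels u v -> eval h u = eval h v.
Proof.
move=> h_rels u v; elim=> {u v}.
- by [].
- by [].
- by move=> u v w _ -> _ ->.
- by move=> u u' v v' _ e1 _ e2; rewrite !eval_cat e1 e2.
- move=> x b; rewrite /eval !big_cons !big_nil mulg1.
  by case: b; rewrite /= ?mulgV ?mulVg.
- by move=> w /h_rels ->; rewrite /eval big_nil.
Qed.

End Evaluation.

Section PresentedGroups.
Local Open Scope group_scope.
Variables (X : choiceType) (rels : classical_sets.set (word X)).

Definition gen (x : X) : presented rels := pres_class rels (letter x).

Lemma pres_classM u v :
  pres_class rels (u ++ v) = pres_class rels u * pres_class rels v.
Proof. by rewrite -pres_mulE. Qed.

Lemma pres_class_eval (w : word X) : pres_class rels w = eval gen w.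
Proof.
elim: w => [|[x b] w IHw]; first by rewrite /eval big_nil.
rewrite -cat1s pres_classM eval_cat IHw; congr (_ * _).
rewrite /eval big_seq1; case: b => //=.
apply: (mulgI (gen x)); rewrite mulgV -pres_classM.
by apply/pres_classP; exact: pres_cancel.
Qed.

Lemma eval_gen_rel w : rels w -> eval gen w = 1.
Proof.
by move=> rw; rewrite -pres_class_eval; apply/pres_classP; exact: pres_rel.
Qed.

Lemma eval_gen_relation u v : rels (relation u v) -> eval gen u = eval gen v.
Proof. by move/eval_gen_rel; rewrite eval_cat eval_inv => /divg1_eq. Qed.

(** Stated with left multiplication by single letters, so that a set of normal
    forms is shown to be everything by letting each letter act on it. *)
Lemma presented_ind (P : presented rels -> Prop) :
    P 1 -> (forall x g, P g -> P (gen x * g)) ->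
    (forall x g, P g -> P ((gen x)^-1 * g)) ->
  forall g, P g.
Proof.
move=> P1 PM PV g; rewrite -(pres_classK g) pres_class_eval.
elim: (generic_quotient.repr g) => [|[x b] w IHw].
  by rewrite /eval big_nil.
by rewrite /eval big_cons; case: b; [exact: PV | exact: PM].
Qed.

Section Extension.
Variables (H : groupType) (h : X -> H).
Hypothesis h_rels : forall w, rels w -> eval h w = 1.

(** Von Dyck: an assignment of the generators that kills the relators extends
    to the presented group. *)
Definition pres_ext (g : presented rels) : H :=
  eval h (generic_quotient.repr g).

Lemma pres_ext_class w : pres_ext (pres_class rels w) = eval h w.
Proof. by apply: eval_pres_cong h_rels _ _ _; exact: repr_pres_class. Qed.

Lemma pres_ext_gen x : pres_ext (gen x) = h x.
Proof. by rewrite pres_ext_class eval_letter. Qed.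

Lemma pres_extM : {morph pres_ext : g g' / g * g'}.
Proof.
move=> g g'; rewrite -(pres_classK g) -(pres_classK g') -pres_classM.
by rewrite !pres_ext_class eval_cat.
Qed.

Lemma pres_ext1 : pres_ext 1 = 1.
Proof. by apply: (mulgI (pres_ext 1)); rewrite -pres_extM !mulg1. Qed.

End Extension.
End PresentedGroups.

Lemma isomorphic_of_bij (G H : groupType) (phi : G -> H) :
  {morph phi : x y / (x * y)%g} -> bijective phi -> isomorphic G H.
Proof.
move=> phiM bij; pose c := isMultiplicative.Build _ _ phi phiM.
pose phi' : {multiplicative G -> H} :=
  HB.pack_for {multiplicative G -> H} phi c.
by exists phi'.
Qed.

Lemma isomorphic_sym (G H : groupType) : isomorphic G H -> isomorphic H G.
Proof.
move=> [phi [psi phiK psiK]].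
apply: (isomorphic_of_bij (can2_gmulfM phiK psiK)).
by exists phi.
Qed.

Lemma isomorphic_trans (G H K : groupType) :
  isomorphic G H -> isomorphic H K -> isomorphic G K.
Proof.
move=> [phi phi_bij] [psi psi_bij].
apply: (@isomorphic_of_bij _ _ (psi \o phi)); last exact: bij_comp.
by move=> x y /=; rewrite !gmulfM.
Qed.

Lemma inj_surj_bij (T : choiceType) (T' : eqType) (f : T -> T') :
  injective f -> (forall y, exists x, f x = y) -> bijective f.
Proof.
move=> f_inj f_surj.
have ex y : exists x, f x == y by have [x <-] := f_surj y; exists x.
exists (fun y => xchoose (ex y)) => [x|y]; last exact/eqP/(xchooseP (ex y)).
by apply: f_inj; exact/eqP/(xchooseP (ex _)).
Qed.

(** * Products of generators along an arithmetic progression *)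

Section Runs.
Local Open Scope group_scope.
Variables (H : groupType) (x : int -> H) (f : int).

(** The product of k factors x_i x_(i+f) x_(i+2f) ... , extended to negative k
    so that [runS] holds for every integer k; [run_uniq] says that this
    recurrence determines it.  It is t^i y^k t^(-kf) t^(-i) in the notation
    above. *)
Definition run (i k : int) : H :=
  match k with
  | Posz p => \prod_(0 <= j < p) x (i + j%:Z * f)%R
  | Negz p => (\prod_(0 <= j < p.+1) x (i + (k + j%:Z) * f)%R)^-1
  end.

Lemma run0 i : run i 0%R = 1.
Proof. by rewrite /= big_geq. Qed.

Lemma runS i k : run i (k + 1)%R = run i k * x (i + k * f)%R.
Proof.
case: k => p; first by rewrite -PoszD addn1 /= big_nat_recr.
have -> : (Negz p + 1)%R = (- p%:Z)%R by rewrite NegzE; lia.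
rewrite /= big_nat_recl // addr0 invgM.
rewrite -mulgA mulVg mulg1.
rewrite [X in X^-1](_ : _ = \prod_(0 <= j < p) x (i + (- p%:Z + j%:Z) * f)%R).
  by case: p => [|p] /=; rewrite ?(big_geq (leqnn 0)) ?invg1.
by apply: eq_bigr => j _; congr (x (_ + _ * _)%R); lia.
Qed.

Lemma run_uniq i (u : int -> H) : u 0%R = 1 ->
  (forall k, u (k + 1)%R = u k * x (i + k * f)%R) -> forall k, u k = run i k.
Proof.
move=> u0 uS; apply: int_ind_iff => [|k]; first by rewrite u0 run0.
by rewrite uS runS; split=> [->|/mulIg].
Qed.

Lemma run1 i : run i 1%R = x i.
Proof. by rewrite -[1%R]add0r runS run0 mul1g mul0r addr0. Qed.

(** The cocycle rule: after k factors the subscript has advanced by k f. *)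
Lemma runD i k l : run i (k + l)%R = run i k * run (i + k * f)%R l.
Proof.
elim/int_ind_iff: l => [|l]; first by rewrite run0 mulg1 addr0.
rewrite addrA !runS !mulgA mulrDl addrA.
by split=> [->|/mulIg].
Qed.

Lemma runV i k : (run i k)^-1 = run (i + k * f)%R (- k)%R.
Proof. by apply: (mulgI (run i k)); rewrite -runD subrr run0 mulgV. Qed.

End Runs.

Lemma run_ext (H H' : groupType) (phi : H -> H') (x : int -> H) f i k :
    phi 1%g = 1%g -> {morph phi : g g' / (g * g')%g} ->
  phi (run x f i k) = run (phi \o x) f i k.
Proof.
move=> phi1 phiM.
apply: (@run_uniq _ (phi \o x) f i (fun k => phi (run x f i k))).
  by rewrite run0.
by move=> {}k; rewrite runS phiM.
Qed.

Section PeriodicRuns.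
Local Open Scope group_scope.
Variables (H : groupType) (x : int -> H) (n r : nat) (s f A : int).
Hypothesis f_rs : eqm n (f * r) (f * s).
Hypothesis x_mod : forall i j, eqm n i j -> x i = x j.

Lemma eq_run_start i j k : eqm n i j -> run x f i k = run x f j k.
Proof.
move=> ij; apply: run_uniq => [|{}k]; first exact: run0.
by rewrite runS; congr (_ * _); apply: x_mod; rewrite ij.
Qed.

Hypothesis run_rs : forall i, run x f i r = run x f (i + A)%R s.

(** The relation y^r = t^A y^s t^(-A), raised to the power k.  It uses
    f r = f s modulo n: blocks of r factors on one side and of s factors on
    the other advance the subscript by the same amount. *)
Lemma run_scale i k : run x f i (r%:Z * k)%R = run x f (i + A)%R (s * k)%R.
Proof.
elim/int_ind_iff: k => [|k]; first by rewrite !mulr0 !run0.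
rewrite !mulrDr !mulr1 !runD.
rewrite run_rs (@eq_run_start (i + A + s * k * f)%R (i + r%:Z * k * f + A)%R).
  by split=> [->|/mulIg].
have rE : (i + r%:Z * k * f + A = i + f * r%:Z * k + A)%R by ring.
have sE : (i + A + s * k * f = i + f * s * k + A)%R by ring.
by rewrite rE sE f_rs.
Qed.

Lemma run_scale_pow i k (p : nat) :
  run x f i (r%:Z ^+ p * k)%R = run x f (i + A * p%:Z)%R (s ^+ p * k)%R.
Proof.
elim: p i k => [|p IHp] i k; first by rewrite !expr0 mulr0 addr0.
rewrite exprS -mulrA run_scale mulrCA IHp exprSr mulrA.
by rewrite intS mulrDr mulr1 addrA.
Qed.

Let D : int := (r%:Z ^+ n - s ^+ n)%R.

(** Exchanging r for s and shifting by A n times turns a run of length r^n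
    into one of length s^n with the same starting subscript. *)
Lemma run_period i : run x f i D = 1.
Proof.
(* A run of length s^n ending just before i, prolonged by D, has length r^n. *)
apply: (mulgI (run x f (i - s ^+ n * f)%R (s ^+ n)%R)).
rewrite mulg1 -[X in _ * run _ _ X _](subrK (s ^+ n * f)%R i) -runD.
rewrite /D [X in run _ _ _ X]addrC subrK -[(r%:Z ^+ n)%R]mulr1.
rewrite run_scale_pow mulr1.
by apply: eq_run_start; rewrite mulrC addrC eqm_MDl.
Qed.

Lemma eq_run_length i k l : eqm D k l -> run x f i k = run x f i l.
Proof.
move=> /eqm_dvd/dvdzP[q kl]; rewrite -(subrK l k) kl addrC runD.
suff -> : forall j, run x f j (q * D)%R = 1 by rewrite mulg1.
elim/int_ind_iff: q {kl} => [|q]; first by move=> j; rewrite mul0r run0.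
rewrite mulrDl mul1r; split=> h j; move: (h j);
  by rewrite runD run_period mulg1.
Qed.

Variables (rhat Abar : int).
Hypotheses (n_gt0 : (0 < n)%N) (rhatP : eqm D (r%:Z * rhat)%R 1%R).
Hypothesis (AbarP : eqm n (A * Abar)%R 1%R).
Local Notation Q := (s * rhat)%R.

(** As rhat k r = k modulo D, a run of length k is one of length r (rhat k). *)
Lemma run_shift i k : run x f i k = run x f (i + A)%R (Q * k)%R.
Proof.
rewrite -mulrA -run_scale mulrA; apply: eq_run_length.
by rewrite rhatP mul1r.
Qed.

Lemma run_shiftn i k (p : nat) :
  run x f i k = run x f (i + A * p%:Z)%R (Q ^+ p * k)%R.
Proof.
elim: p i k => [|p IHp] i k; first by rewrite mulr0 addr0 expr0 mul1r.
by rewrite run_shift IHp intS mulrDr mulr1 addrA exprSr mulrA.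
Qed.

(** Since A Abar = 1 modulo n, shifting the subscript i by A as many times as
    the residue of -i Abar modulo n brings it to 0. *)
Lemma run_from0 i k : run x f i k = run x f 0%R (cpow n Q (- (i * Abar)) * k)%R.
Proof.
rewrite (run_shiftn i k `|(- (i * Abar) %% n)%Z|) -/(cpow n _ _).
apply: eq_run_start; rewrite gez0_abs ?modz_ge0 -?lt0n //.
have iE : (i + A * - (i * Abar) = i * (1 - A * Abar))%R by ring.
by rewrite eqm_modz iE AbarP subrr mulr0.
Qed.

End PeriodicRuns.

(** * Twisted products on the integers modulo m *)

(** What makes k . l = k + t(k) l a group law on Z/m.  The last condition
    gives t(k + t(k) l) = t(k) t(l) modulo m: the twist is a morphism for the
    law that it defines, which is associativity. *)
Record twist := Twist {
  tw_mod : nat;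
  tw :> int -> int;
  tw_gt0 : (0 < tw_mod)%N;
  tw0 : tw 0 = 1;
  eq_tw : forall k l, eqm tw_mod k l -> tw k = tw l;
  twD : forall k l, eqm tw_mod (tw (k + l)) (tw k * tw l);
  twM : forall k l, tw (tw k * l) = tw l
}.

Definition twisted (t : twist) : predArgType := 'I_(tw_mod t).
HB.instance Definition _ t := Finite.on (twisted t).

Section TwistedGroup.
Variable t : twist.
Local Notation m := (tw_mod t).
Implicit Types (k l : int) (g h : twisted t).

Definition res k : twisted t := Ordinal (modz_ltn k (tw_gt0 t)).
Definition rep g : int := (g : 'I_m)%:Z.

Lemma resP k l : res k = res l <-> eqm m k l.
Proof.
have m0 : m%:Z != 0 by rewrite -lt0n tw_gt0.
split=> [[kl]|kl]; last by apply: val_inj; rewrite /= kl.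
by rewrite /eqm -(gez0_abs (modz_ge0 k m0)) kl gez0_abs ?modz_ge0.
Qed.

Lemma repK : cancel rep res.
Proof. by move=> g; apply: val_inj; rewrite /= modz_nat /= modn_small. Qed.

Lemma resK k : eqm m (rep (res k)) k.
Proof. exact/resP/repK. Qed.

Definition twisted_mul g h := res (rep g + t (rep g) * rep h).
Definition twisted_inv g := res (- (t (- rep g) * rep g)).

Lemma twisted_mulE k l : twisted_mul (res k) (res l) = res (k + t k * l).
Proof. by apply/resP; rewrite (eq_tw (resK k)) !resK. Qed.

Lemma twisted_mulA : associative twisted_mul.
Proof.
move=> g h j; rewrite -(repK g) -(repK h) -(repK j) !twisted_mulE.
apply/resP; rewrite twD twM.
by rewrite mulrDr addrA mulrA.
Qed.

Lemma twisted_mul1 : left_id (res 0) twisted_mul.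
Proof. by move=> g; rewrite -(repK g) twisted_mulE tw0 mul1r add0r. Qed.

Lemma twisted_mulV : left_inverse (res 0) twisted_inv twisted_mul.
Proof.
move=> g; rewrite -{2}(repK g) twisted_mulE; apply/resP.
by rewrite -mulrN twM addrC mulrN subrr.
Qed.

HB.instance Definition _ :=
  Finite_isGroup.Build (twisted t) twisted_mulA twisted_mul1 twisted_mulV.

Lemma resM k l : (res k * res l)%g = res (k + t k * l).
Proof. exact: twisted_mulE. Qed.

Lemma res0 : res 0 = 1%g.
Proof. by []. Qed.

Lemma card_twisted : #|twisted t| = m.
Proof. exact: card_ord. Qed.

End TwistedGroup.

(** * Metacyclic presentations of twisted products *)

Section FactoredGroup.
Local Open Scope group_scope.
Variables (gT : finGroupType) (a b : gT).
Hypothesis ab_gen : forall g, exists i j, g = expgz a i * expgz b j.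

Lemma mem_expgz (g : gT) k : expgz g k \in <[g]>.
Proof. by case: k => m; rewrite ?groupV mem_cycle. Qed.

(** <[a]> is normalised by b, hence normal, and the quotient by it is generated
    by the coset of b. *)
Lemma metacyclic_of_factorization R :
  b * a * b^-1 = expgz a R -> metacyclic [set: gT].
Proof.
move=> bab; have nab : b \in 'N(<[a]>).
  rewrite -groupV inE -cycleJ cycle_subG conjgE invgK mulgA bab.
  exact: mem_expgz.
have nT : [set: gT] \subset 'N(<[a]>).
  apply/subsetP=> g _; have [i [j ->]] := ab_gen g.
  rewrite groupM //; first by rewrite (subsetP (normG _)) ?mem_expgz.
  have /subsetP: <[b]> \subset 'N(<[a]>) by rewrite cycle_subG.
  by apply; exact: mem_expgz.
apply/existsP; exists <[a]>%G; apply/and3P; split.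
- exact: cycle_cyclic.
- by rewrite /normal subsetT.
apply: (cyclicS _ (cycle_cyclic (coset <[a]> b))).
apply/subsetP=> _ /morphimP[g nag _ ->]; have [i [j ->]] := ab_gen g.
rewrite morphM ?(subsetP nT) ?inE //=.
rewrite (coset_id (mem_expgz a i)) mul1g.
have nb := subsetP nT _ (in_setT (expgz b j)).
have := mem_morphim (coset_morphism <[a]>) nb (mem_expgz b j).
by rewrite morphim_cycle.
Qed.

End FactoredGroup.

Section GroupB.
Variables (M N R lam : int).
Local Notation e := (lam * M %/ gcdz M (R - 1))%Z.
Local Notation B := (groupB M N R lam).

Definition groupB_gen (c : bool) : B := gen _ c.
Local Notation a := (groupB_gen false).
Local Notation b := (groupB_gen true).

Lemma groupB_hom (H : groupType) (al be : H)
    (h := fun c : bool => if c then be else al) :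
    expgz al M = 1%g -> (be * al * be^-1)%g = expgz al R ->
    expgz be N = expgz al e ->
  exists phi : B -> H, [/\ phi 1%g = 1%g, {morph phi : g g' / (g * g')%g},
     phi a = al & phi b = be].
Proof.
move=> aM ba bN.
have h_rels w :
      (w = word_expz (letter false) M \/
       w = relation (letter true ++ letter false ++ word_inv (letter true))
             (word_expz (letter false) R)) \/
      w = relation (word_expz (letter true) N) (word_expz (letter false) e) ->
    eval h w = 1%g.
  case=> [[->|->]|->].
  - by rewrite eval_expz eval_letter.
  - apply: eval_relation.
    by rewrite !eval_cat eval_inv eval_expz !eval_letter mulgA.
  - by apply: eval_relation; rewrite !eval_expz !eval_letter.
exists (pres_ext h); split; first exact: pres_ext1.
- exact: pres_extM.
- exact: (pres_ext_gen h_rels).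
- exact: (pres_ext_gen h_rels).
Qed.

Lemma groupB_aM : expgz a M = 1%g.
Proof.
have: eval (gen _) (word_expz (letter false) M) = 1%g :> B.
  by apply: eval_gen_rel; left; left.
by rewrite eval_expz eval_letter.
Qed.

Lemma groupB_bab : (b * a * b^-1)%g = expgz a R.
Proof.
have: eval (gen _) (letter true ++ letter false ++ word_inv (letter true)) =
      eval (gen _) (word_expz (letter false) R) :> B.
  by apply: eval_gen_relation; left; right.
by rewrite !eval_cat eval_inv eval_expz !eval_letter mulgA.
Qed.

Lemma groupB_bN : expgz b N = expgz a e.
Proof.
have: eval (gen _) (word_expz (letter true) N) =
      eval (gen _) (word_expz (letter false) e) :> B.
  by apply: eval_gen_relation; right.
by rewrite !eval_expz !eval_letter.
Qed.

Lemma groupB_eq_a k l : eqm M k l -> expgz a k = expgz a l.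
Proof.
move=> /eqm_dvd/dvdzP[q kl]; rewrite -(subrK l k) kl expgzD mulrC expgzM.
by rewrite groupB_aM; case: q {kl} => q; rewrite /= expg1n ?invg1 mul1g.
Qed.

Lemma groupB_b_a k : (b * expgz a k)%g = (expgz a (R * k) * b)%g.
Proof.
rewrite expgzM -groupB_bab.
have <- : (b * expgz a k * b^-1)%g = expgz (b * a * b^-1)%g k.
  apply: (morph_expgz (phi := fun g => (b * g * b^-1)%g)) => [|g g'].
    by rewrite mulg1 mulgV.
  by rewrite !mulgA mulgVK.
by rewrite mulgVK.
Qed.

(** R' inverts the action of b on <a>, which lets b^-1 move past powers
    of a. *)
Lemma groupB_normal_form R' : eqm M (R * R') 1 ->
  forall g : B, exists i j, g = (expgz a i * expgz b j)%g.
Proof.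
move=> RR'; apply: presented_ind.
- by exists 0, 0; rewrite mulg1.
- move=> c _ [i [j ->]]; case: c; rewrite -/(groupB_gen _).
    exists (R * i), (1 + j).
    by rewrite expgzD expgz1 mulgA groupB_b_a mulgA.
  by exists (1 + i), j; rewrite expgzD expgz1 mulgA.
- move=> c _ [i [j ->]]; case: c; rewrite -/(groupB_gen _).
    exists (R' * i), (- 1 + j).
    rewrite expgzD expgzN expgz1 !mulgA; congr (_ * _)%g.
    apply: (mulgI b); rewrite mulVKg mulgA groupB_b_a mulgK.
    by apply: groupB_eq_a; rewrite mulrA RR' mul1r.
  by exists (- 1 + i), j; rewrite expgzD expgzN expgz1 mulgA.
Qed.

End GroupB.

Lemma dvdz_normr d k : (d %| `|k|)%Z = (d %| k)%Z.
Proof. by rewrite !dvdzE; case: k. Qed.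

(** A twisted product on Z/m, with m = |N M|, whose twist is trivial on the
    multiples of N.  It is identified with B by a |-> N u and b |-> 1, where
    the unit u is there to match b^N with the prescribed power of a. *)
Section GroupBTwisted.
Variables (t : twist) (M R lam u v e : int) (N : nat).
Local Notation m := (tw_mod t).
Hypotheses (eE : e = (lam * M %/ gcdz M (R - 1))%Z).
Hypotheses (mE : m%:Z = `|N%:Z * M|) (twN : forall k : int, t (N%:Z * k) = 1).
Hypotheses (twN1 : forall k, eqm N (t k) 1) (Rt : eqm m R (t 1)).
Hypotheses (uv : eqm m (u * v) 1).
Hypothesis sumN : eqm m (\sum_(i < N) t 1 ^+ i) (N%:Z * u * e).

Let al : twisted t := res t (N%:Z * u).
Let be : twisted t := res t 1.

Let m_neq0 : m%:Z != 0. Proof. by rewrite -lt0n tw_gt0. Qed.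
Let N_neq0 : N%:Z != 0.
Proof. by apply: contra_neq m_neq0 => N0; rewrite mE N0 mul0r normr0. Qed.
Let dvd_m d : (m %| d)%Z = (N%:Z * M %| d)%Z.
Proof. by rewrite !dvdzE mE; case: (_ * M). Qed.
Let M_dvd_m : (M %| m%:Z)%Z.
Proof. by rewrite mE dvdz_normr dvdz_mull. Qed.

Let tw_idN k l : t (N%:Z * k) * l = l.
Proof. by rewrite twN mul1r. Qed.

Let al_expgz i : expgz al i = res t (N%:Z * (u * i)).
Proof.
apply/esym; apply: (expgz_uniq (p := fun i => res t (N%:Z * (u * i)))) => [|k].
  by rewrite !mulr0.
by rewrite resM tw_idN; congr (res t _); ring.
Qed.

Let be_expgz_nat (j : nat) : expgz be j = res t (\sum_(i < j) t 1 ^+ i).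
Proof.
elim: j => [|j IH]; first by rewrite big_ord0.
rewrite intS expgzD expgz1 IH resM big_ord_recl expr0 mulr_sumr.
by congr (res t (_ + _)); apply: eq_bigr => i _; rewrite exprS.
Qed.

Let N_dvd_m : (N%:Z %| m%:Z)%Z.
Proof. by rewrite mE dvdz_normr dvdz_mulr. Qed.

Let resN k : eqm N (rep (res t k)) k.
Proof. exact: eqm_dvdl N_dvd_m (resK t k). Qed.

(** Reduction modulo N is a morphism onto Z/N, because t = 1 modulo N. *)
Let rep_mulN (g h : twisted t) : eqm N (rep (g * h)%g) (rep g + rep h).
Proof. by rewrite -{1}(repK g) -{1}(repK h) resM resN twN1 mul1r. Qed.

Let be_expgz_mod j : eqm N (rep (expgz be j)) j.
Proof.
elim/int_ind_iff: j => [|j]; first exact: resN.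
rewrite expgzS rep_mulN resN.
by rewrite !eqm_dvd opprD addrACA subrr addr0.
Qed.

Let al_expgz_mod i : eqm N (rep (expgz al i)) 0.
Proof. by rewrite al_expgz resN; apply/eqm0; rewrite dvdz_mulr. Qed.

Let factorization (g : twisted t) : exists i j, g = (expgz al i * expgz be j)%g.
Proof.
pose h := (g * expgz be (- rep g))%g.
have /dvdzP[w hw] : (N%:Z %| rep h)%Z.
  by apply/eqm0; rewrite rep_mulN be_expgz_mod subrr.
exists (v * w), (rep g).
suff -> : expgz al (v * w) = h by rewrite /h expgzN mulgVK.
rewrite al_expgz -(repK h) hw; apply/resP.
by rewrite mulrA mulrA -(mulrA N%:Z) uv mulr1 mulrC.
Qed.

Let al_bal : (be * al * be^-1)%g = expgz al R.
Proof.
apply: (mulIg be); rewrite mulgVK al_expgz !resM tw_idN.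
by apply/resP; rewrite Rt -[t 1 * _]mulrC addrC mulrA.
Qed.

Let be_N : expgz be N = expgz al e.
Proof. by rewrite be_expgz_nat al_expgz mulrA; apply/resP. Qed.

Let al_eq1 i : expgz al i = 1%g <-> (M %| i)%Z.
Proof.
rewrite al_expgz -res0; split=> [/resP/eqm0|Mi].
  rewrite dvd_m dvdz_mul2l // => /(dvdz_mull v)/eqm0 vui.
  by apply/eqm0; rewrite -vui mulrA [v * u]mulrC (eqm_dvdl M_dvd_m uv) mul1r.
by apply/resP/eqm0; rewrite dvd_m dvdz_mul2l // dvdz_mull.
Qed.

Lemma twisted_metacyclic : metacyclic [set: twisted t].
Proof.
exact: (@metacyclic_of_factorization (twisted t) al be factorization R al_bal).
Qed.

Lemma groupB_twisted : isomorphic (groupB M N R lam) (twisted t).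
Proof.
have aM : expgz al M = 1%g by apply/al_eq1.
have bN : expgz be N = expgz al (lam * M %/ gcdz M (R - 1))%Z by rewrite -eE.
have [phi [phi1 phiM phia phib]] := groupB_hom aM al_bal bN.
have phiX (g : groupB M N R lam) k : phi (expgz g k) = expgz (phi g) k.
  exact: morph_expgz.
(* t(-1) inverts R = t(1). *)
have R_unit : eqm M (R * t (- 1)) 1.
  apply: eqm_dvdl M_dvd_m _.
  by rewrite Rt -twD subrr tw0.
have normal_form := groupB_normal_form (N := N) (lam := lam) R_unit.
apply: (@isomorphic_of_bij _ _ phi phiM); apply: inj_surj_bij; last first.
  move=> k; have [i [j ->]] := factorization k.
  eexists (_ * _)%g; rewrite phiM.
  by congr (_ * _)%g; rewrite -?phia -?phib -phiX.
(* The image of a^i b^j is j modulo N, so j = N q in the kernel; then b^j is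
   a power of a, and the image of <a> is faithful. *)
have ker (g : groupB M N R lam) : phi g = 1%g -> g = 1%g.
  have [i [j ->]] := normal_form g; rewrite phiM !phiX phia phib => ij1.
  have /dvdzP[q jq] : (N%:Z %| j)%Z.
    apply/eqm0; rewrite -(be_expgz_mod j) -[rep _]add0r -(al_expgz_mod i).
    by rewrite -rep_mulN ij1 -res0 resN al_expgz_mod.
  move: ij1; rewrite jq mulrC !(expgzM _ N) be_N groupB_bN -eE.
  rewrite -!expgzM -!expgzD.
  by move/al_eq1/eqm0/groupB_eq_a=> ->.
move=> g g' gg'; apply/divg1_eq/ker; rewrite phiM.
have -> : phi g'^-1%g = (phi g')^-1%g.
  by apply: (mulgI (phi g')); rewrite -phiM !mulgV.
by rewrite gg' mulgV.
Qed.

End GroupBTwisted.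

(** * The groups in class M are twisted products *)

Section ClassMRelator.
Variables (n : nat) (n_gt0 : (0 < n)%N).

Definition subscript (z : int) : 'I_n := Ordinal (modz_ltn z n_gt0).

Let n_neq0 : n%:Z != 0. Proof. by rewrite -lt0n. Qed.

Lemma eq_subscript z w : eqm n z w -> subscript z = subscript w.
Proof. by move=> zw; apply: val_inj; rewrite /= zw. Qed.

Lemma subscript_ord (i : 'I_n) : subscript i%:Z = i.
Proof. by apply: val_inj; rewrite /= modz_nat /= modn_small. Qed.

Lemma ordS_subscript z : ordS (subscript z) = subscript (z + 1).
Proof.
rewrite -[LHS]subscript_ord; apply: eq_subscript.
rewrite /= -modz_nat eqm_modz intS gez0_abs ?modz_ge0 //.
by rewrite eqm_modz addrC.
Qed.

Variables (r : nat) (s f A : int).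
Hypothesis f_rs : eqm n (f * r%:Z) (f * s).

Lemma eval_shift (H : groupType) (h : 'I_n -> H) w :
  eval h (shift w) = eval (h \o @ordS n) w.
Proof. by rewrite /eval /shift big_map. Qed.

Lemma eval_iter_shift (H : groupType) (h : 'I_n -> H) w (j : nat) :
  eval h (iter j (@shift n) w) = eval (h \o iter j (@ordS n)) w.
Proof.
elim: j h => [|j IH] h //; rewrite iterS eval_shift IH.
by apply: eq_bigr => -[i b] _ /=; rewrite -iterS iterSr.
Qed.

Lemma iter_ordS (j : nat) z :
  iter j (@ordS n) (subscript z) = subscript (z + j%:Z).
Proof.
elim: j => [|j IH]; first by rewrite addr0.
by rewrite iterS IH ordS_subscript -addrA [j%:Z + 1]addrC -intS.
Qed.

(** The shifted relator compares a run of length r starting at j with a run of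
    length s starting at j + A.  For s < 0 its second half is a product of |s|
    factors starting at j + A + r f; this is the inverse of a run of length s
    from j + A, as r f = s f modulo n. *)
Lemma eval_classM_relator (H : groupType) (h : 'I_n -> H) (j : nat)
    (x := fun z => h (subscript z)) :
  eval h (iter j (@shift n) (classM_relator n_gt0 r s f A)) =
  (run x f j%:Z r%:Z * (run x f (j%:Z + A)%R s)^-1)%g.
Proof.
have evalx z : eval (h \o iter j (@ordS n)) (genz n_gt0 z) = x (j%:Z + z).
  by rewrite eval_letter /= -/(subscript z) iter_ordS addrC.
rewrite eval_iter_shift eval_cat eval_bigcat; congr (_ * _)%g.
  by apply: eq_bigr => i _; rewrite evalx.
case: s f_rs => p f_rp /=.
  rewrite eval_inv eval_bigcat; congr (_ ^-1)%g.
  by apply: eq_bigr => i _; rewrite evalx addrA.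
rewrite invgK eval_bigcat; apply: eq_bigr => i _; rewrite evalx.
congr h; apply: eq_subscript.
rewrite !mulrDl -[r%:Z * f]mulrC f_rp.
have -> : j%:Z + (A + (f * Negz p + i%:Z * f)) =
          j%:Z + A + (Negz p * f + i%:Z * f) by ring.
reflexivity.
Qed.

End ClassMRelator.

Section ClassM.
Variables (r n : nat) (s f A rhat Abar : int) (n_gt0 : (0 < n)%N).
Let D : int := r%:Z ^+ n - s ^+ n.
Local Notation Q := (s * rhat).
Hypotheses (f_rs : eqm n (f * r%:Z) (f * s)) (D_neq0 : D != 0).
Hypotheses (rhatP : eqm D (r%:Z * rhat) 1) (AbarP : eqm n (A * Abar) 1).

Lemma classM_Q_order : eqm `|D|%N (Q ^+ n) 1.
Proof.
have rs_n : eqm D (s ^+ n) (r%:Z ^+ n).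
  by rewrite eqm_dvd -opprB dvdzE abszN -dvdzE.
by rewrite eqm_abs exprMn rs_n -exprMn rhatP expr1n.
Qed.

Lemma classM_f_D : eqm n (f * D) 0.
Proof.
have fX (p : nat) : eqm n (f * r%:Z ^+ p) (f * s ^+ p).
  elim: p => [|p IH] //.
  by rewrite !exprS !mulrA f_rs mulrAC IH mulrAC.
by rewrite /D mulrBr fX subrr.
Qed.

(** As f D = 0 modulo n, also f r rhat = f, and f Q = f s rhat = f r rhat. *)
Lemma classM_f_Q : eqm n (f * Q) f.
Proof.
have /eqm_dvd/dvdzP[q rq] := rhatP.
rewrite mulrA -f_rs -mulrA -[r%:Z * rhat](subrK 1) rq mulrDr mulr1.
by rewrite [q * _]mulrC mulrA classM_f_D mul0r add0r.
Qed.

Let F : int := f * Abar.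

Lemma classM_F_D : eqm n (D * F) 0.
Proof. by rewrite /F mulrA [D * f]mulrC classM_f_D mul0r. Qed.

Lemma classM_F_cpow z : eqm n (cpow n Q z * F) F.
Proof.
rewrite /cpow; elim: `|_|%N => [|p IH]; first by rewrite mul1r.
by rewrite exprSr -mulrA /F (mulrA Q) [Q * f]mulrC classM_f_Q.
Qed.

Lemma classM_tw0 : cpow n Q (0 * F) = 1.
Proof. by rewrite mul0r cpow0. Qed.

Lemma classM_eq_tw k l :
  eqm `|D|%N k l -> cpow n Q (k * F) = cpow n Q (l * F).
Proof.
rewrite eqm_abs => /eqm_dvd/dvdzP[q kl]; apply: eq_cpow.
by rewrite -(subrK l k) kl mulrDl -mulrA classM_F_D mulr0 add0r.
Qed.

Lemma classM_twD k l :
  eqm `|D|%N (cpow n Q ((k + l) * F)) (cpow n Q (k * F) * cpow n Q (l * F)).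
Proof. by rewrite mulrDl; apply: cpowD => //; exact: classM_Q_order. Qed.

Lemma classM_twM k l : cpow n Q (cpow n Q (k * F) * l * F) = cpow n Q (l * F).
Proof. by apply: eq_cpow; rewrite mulrAC classM_F_cpow mulrC. Qed.

Lemma classM_gt0 : (0 < `|D|)%N.
Proof. by rewrite absz_gt0. Qed.

(** The law k . l = k + Q^(k f Abar) l modulo |D|. *)
Definition classM_twist : twist :=
  Twist classM_gt0 classM_tw0 classM_eq_tw classM_twD classM_twM.

Local Notation t := classM_twist.
Local Notation E i := (cpow n Q (- (i * Abar))).
Local Notation G := (classM_group n_gt0 r s f A).

(** As a run of length 1, x_z equals the run of length E z starting at 0. *)
Let x (z : int) : twisted t := res t (E z).

Let x_subscript z : x (subscript n_gt0 z)%:Z = x z.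
Proof.
congr res; apply: eq_cpow; rewrite /= gez0_abs ?modz_ge0 -?lt0n //.
by rewrite eqm_modz.
Qed.

(** [run_from0] turns this run into one from 0 of length E i * k. *)
Let run_x i k : run x f i k = res t (E i * k).
Proof.
apply/esym; apply: (run_uniq (u := fun k => res t (E i * k))) => [|{}k].
  by rewrite mulr0.
rewrite resM mulrDr; apply/resP.
rewrite /= -cpowD //; last exact: classM_Q_order.
rewrite (@eq_cpow _ _ (_ + _) (- (i * Abar))) ?mulr1 //.
rewrite mulrAC classM_F_cpow.
have -> : F * k + - ((i + k * f) * Abar) = - (i * Abar) by rewrite /F; ring.
reflexivity.
Qed.

Let run_x_rs i : run x f i r%:Z = run x f (i + A) s.
Proof.
rewrite !run_x; apply/resP.
have -> : - ((i + A) * Abar) = - (i * Abar) - A * Abar by ring.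
rewrite (cpowD n_gt0 classM_Q_order).
rewrite (@eq_cpow _ _ (- (A * Abar)) (- 1)); last first.
  by rewrite AbarP.
rewrite -mulrA; apply: eqm_mul => //.
have sE : eqm `|D|%N s (Q * r%:Z).
  by rewrite eqm_abs -mulrA [rhat * _]mulrC rhatP mulr1.
have Q1 : eqm `|D|%N (cpow n Q (- 1) * Q) 1.
  rewrite -{2}[Q]expr1 -(cpow_nat classM_Q_order) mulrC.
  by rewrite (cpowN n_gt0 classM_Q_order).
by rewrite {2}sE mulrA Q1 mul1r.
Qed.

Let h (i : 'I_n) : twisted t := x i%:Z.

Let h_rels w :
    (exists2 j, (j < n)%N &
      iter j (@shift n) (classM_relator n_gt0 r s f A) = w) ->
  eval h w = 1%g.
Proof.
have hx : (fun z => h (subscript n_gt0 z)) =1 x by exact: x_subscript.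
have run_h i k : run (fun z => h (subscript n_gt0 z)) f i k = run x f i k.
  apply: (run_uniq (u := run _ f i)) => [|{}k]; first exact: run0.
  by rewrite runS hx.
case=> j _ <-; rewrite eval_classM_relator //.
by rewrite !run_h run_x_rs mulgV.
Qed.

Let y (z : int) : G := gen _ (subscript n_gt0 z).

Let y_mod i j : eqm n i j -> y i = y j.
Proof. by move=> ij; rewrite /y (eq_subscript n_gt0 ij). Qed.

Let run_rs i : run y f i r%:Z = run y f (i + A) s.
Proof.
pose j := `|(i %% n)%Z|%N.
have ij : eqm n i j by rewrite gez0_abs ?modz_ge0 -?lt0n // eqm_modz.
rewrite (eq_run_start f y_mod r ij).
rewrite (@eq_run_start _ _ n f y_mod (i + A) (j%:Z + A)).
  apply/divg1_eq; rewrite -(eval_classM_relator n_gt0 A f_rs (gen _)).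
  apply: eval_gen_rel; exists j => //.
  exact: modz_ltn.
by rewrite ij.
Qed.

Let run_y0 i k : run y f i k = run y f 0 (E i * k).
Proof. exact: (run_from0 f_rs y_mod run_rs n_gt0 rhatP AbarP). Qed.

Let run_y_eqm i k l : eqm D k l -> run y f i k = run y f i l.
Proof. exact: (eq_run_length f_rs y_mod run_rs). Qed.

(** The second factor is rewritten to start where the first one ends. *)
Let run_yM k l : exists j, (run y f 0 k * run y f 0 l)%g = run y f 0 j.
Proof.
pose c := k * f * Abar.
exists (k + cpow n Q c * l); rewrite runD add0r; congr (_ * _)%g.
rewrite [RHS]run_y0 -/c; apply/esym/run_y_eqm.
by rewrite -eqm_abs mulrA [_ (- c) * _]mulrC (cpowN n_gt0 classM_Q_order) mul1r.
Qed.

Let run_y_surj (g : G) : exists k, g = run y f 0 k.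
Proof.
elim/presented_ind: g => [|i _ [k ->]|i _ [k ->]].
- by exists 0; rewrite run0.
- have -> : gen _ i = run y f i%:Z 1 by rewrite run1 /y subscript_ord.
  rewrite run_y0; have [j ->] := run_yM (E i%:Z * 1) k; by exists j.
- have -> : gen _ i = run y f i%:Z 1 by rewrite run1 /y subscript_ord.
  rewrite runV (run_y0 (i%:Z + 1 * f)).
  by have [j ->] := run_yM (E (i%:Z + 1 * f) * - 1) k; exists j.
Qed.

Lemma classM_twisted : isomorphic G (twisted t).
Proof.
apply: (@isomorphic_of_bij _ _ (pres_ext h : G -> twisted t)).
  exact: (pres_extM h_rels).
have phiK k : pres_ext h (run y f 0 k) = res t k.
  rewrite (run_ext _ _ _ _ (pres_ext1 h_rels) (pres_extM h_rels)).
  rewrite -(run_uniq (i := 0) (x := pres_ext h \o y) (f := f) (u := run x f 0)).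
  - by rewrite run_x mul0r oppr0 cpow0 mul1r.
  - exact: run0.
  - move=> l; rewrite runS /= /y (pres_ext_gen h_rels).
    by rewrite /h x_subscript.
exists (fun g => run y f 0 (rep g)) => [g|g]; last by rewrite phiK repK.
have [k ->] := run_y_surj g.
by rewrite phiK; apply: run_y_eqm; rewrite -eqm_abs; exact: (resK t).
Qed.

End ClassM.

(** * The arithmetic of the parameters *)

Lemma coprimez_eqm m x y : eqm m (x * y) 1 -> coprimez x m.
Proof.
move=> /eqm_dvd/dvdzP[q xy]; apply/coprimezP; exists (y, - q) => /=.
by rewrite mulNr -xy opprB mulrC addrCA subrr addr0.
Qed.

Lemma eqm_mul2l m c x y : coprimez c m -> eqm m (c * x) (c * y) -> eqm m x y.
Proof.
rewrite coprimez_sym !eqm_dvd -mulrBr => cm.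
by rewrite Gauss_dvdzr.
Qed.

(** Multiplication by c permutes the residues modulo N. *)
Lemma eqm_sum_perm (N : nat) (c : int) (u : int -> int) :
    coprimez c N -> (forall z w, eqm N z w -> u z = u w) ->
  \sum_(i < N) u (c * i%:Z) = \sum_(i < N) u i%:Z.
Proof.
case: N => [|N] cN u_mod; first by rewrite !big_ord0.
pose sigma (i : 'I_N.+1) := subscript (ltn0Sn N) (c * i%:Z).
have subK z : eqm N.+1 (subscript (ltn0Sn N) z)%:Z z.
  by rewrite /= gez0_abs ?modz_ge0 // eqm_modz.
have sigma_inj : injective sigma.
  move=> i j ij; rewrite -(subscript_ord (ltn0Sn N) i).
  rewrite -(subscript_ord (ltn0Sn N) j); apply/eq_subscript/(eqm_mul2l cN).
  rewrite -(subK (c * i%:Z)) -(subK (c * j%:Z)).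
  by rewrite -/(sigma i) ij.
rewrite [RHS](reindex_inj sigma_inj); apply: eq_bigr => i _.
by apply: u_mod; rewrite subK.
Qed.

(** Two factorisations of D are compared: D = N M, and D = T W, which is that
    of (r^d)^N - (s^d)^N by T = r^d - s^d. *)
Section Arithmetic.
Variables (r n : nat) (s f A rhat Abar : int) (n_gt0 : (0 < n)%N).
Let D : int := r%:Z ^+ n - s ^+ n.
Local Notation Q := (s * rhat).
Hypotheses (f_rs : eqm n (f * r%:Z) (f * s)) (D_neq0 : D != 0).
Hypotheses (rhatP : eqm D (r%:Z * rhat) 1) (AbarP : eqm n (A * Abar) 1).

Let d : nat := gcdn n `|f|.
Let N : nat := (n %/ d)%N.
Let c : int := (f %/ d)%Z * Abar.
Let T : int := r%:Z ^+ d - s ^+ d.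
Let W : int := \sum_(i < N) (r%:Z ^+ d) ^+ (N.-1 - i) * (s ^+ d) ^+ i.
Let M : int := (gcdz n f * D %/ n)%Z.

Let d_gt0 : (0 < d)%N. Proof. by rewrite gcdn_gt0 n_gt0. Qed.

Let nE : n%:Z = d%:Z * N%:Z.
Proof. by rewrite -PoszM mulnC divnK ?dvdn_gcdl. Qed.

Let fE : f = d%:Z * (f %/ d)%Z.
Proof. by rewrite mulrC divzK // dvdzE dvdn_gcdr. Qed.

Let N_gt0 : (0 < N)%N.
Proof. by rewrite divn_gt0 // dvdn_leq // dvdn_gcdl. Qed.

Let fd_N : coprimez (f %/ d)%Z N.
Proof.
have d0 : d%:Z != 0 by rewrite -lt0n.
apply/coprimezP; have [x [y]] := Bezoutz f n.
have -> : gcdz f n = d by rewrite gcdzC.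
rewrite {1}fE nE => xy; exists (x, y) => /=; apply: (mulfI d0).
by rewrite mulr1 -[RHS]xy; ring.
Qed.

Let c_N : coprimez c N.
Proof.
have Nn : (N%:Z %| n%:Z)%Z by rewrite nE dvdz_mull.
rewrite /c coprimezMl fd_N /= (@coprimez_eqm _ _ A) // mulrC.
exact: eqm_dvdl Nn AbarP.
Qed.

Let F_c : f * Abar = d%:Z * c.
Proof. by rewrite /c mulrA -fE. Qed.

(** d N divides f (r - s), and f / d is prime to N. *)
Let rs_N : eqm N r%:Z s.
Proof.
apply: (eqm_mul2l fd_N); have d0 : d%:Z != 0 by rewrite -lt0n.
move: f_rs; rewrite !eqm_dvd -!mulrBr {1}fE nE -mulrA dvdz_mul2l //.
Qed.

Let D_TW : D = T * W.
Proof.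
rewrite /D; have -> : n = (d * N)%N by rewrite mulnC divnK ?dvdn_gcdl.
by rewrite !exprM subrXX.
Qed.

(** W has N terms, all congruent to (r^d)^(N-1) modulo N. *)
Let N_dvd_W : (N%:Z %| W)%Z.
Proof.
apply/eqm0; rewrite /W.
rewrite (@eqm_sum N _ _ _ (fun=> (r%:Z ^+ d) ^+ N.-1)) => [|i].
  by rewrite sumr_const card_ord; apply/eqm0; rewrite -mulr_natl natz dvdz_mulr.
rewrite -rs_N -exprD subnK //.
by rewrite -ltnS prednK.
Qed.

Let D_NTW : D = N%:Z * (T * (W %/ N)%Z).
Proof. by rewrite D_TW mulrCA [N%:Z * _]mulrC divzK. Qed.

Let M_TW : M = T * (W %/ N)%Z.
Proof.
rewrite /M -[gcdz n f]/(d%:Z) {1}D_NTW nE mulrA mulKz //.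
by rewrite -nE -lt0n.
Qed.

Let D_NM : D = N%:Z * M. Proof. by rewrite M_TW -D_NTW. Qed.

Let N_dvd_D : (N%:Z %| D)%Z. Proof. by rewrite D_NM dvdz_mulr. Qed.
Let M_dvd_D : (M %| D)%Z. Proof. by rewrite D_NM dvdz_mull. Qed.
Let T_dvd_D : (T %| D)%Z. Proof. by rewrite D_TW dvdz_mulr. Qed.
Let T_neq0 : T != 0.
Proof. by apply: contraNneq D_neq0 => T0; rewrite D_TW T0 mul0r. Qed.

Lemma classM_M_integral : (n%:Z %| gcdz n f * D)%Z.
Proof. by rewrite -[gcdz n f]/(d%:Z) D_NM nE mulrA dvdz_mulr. Qed.

Local Notation t := (classM_twist Abar n_gt0 f_rs D_neq0 rhatP).

Let F_N (k : int) : eqm n (N%:Z * k * (f * Abar)) 0.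
Proof.
rewrite F_c (_ : _ * _ = k * c * n%:Z + 0); first by rewrite eqm_MDl.
by rewrite nE; ring.
Qed.

Let t_n (k : int) : t (N%:Z * k) = 1.
Proof. by rewrite /= (eq_cpow _ (F_N k)) cpow0. Qed.

Let t_N1 k : eqm N (t k) 1.
Proof.
have Q1 : eqm N Q 1 by rewrite -rs_N; exact: eqm_dvdl N_dvd_D rhatP.
by rewrite /= /cpow Q1 expr1n.
Qed.

Let Qn : eqm D (Q ^+ n) 1.
Proof. by rewrite -eqm_abs; exact: classM_Q_order rhatP. Qed.

Variable R : int.
Hypothesis R_t : eqm D R (t 1).

Lemma classM_R_admissible : eqm M (R ^+ N) 1.
Proof.
apply: eqm_dvdl M_dvd_D _; rewrite R_t /= mul1r -(cpowMn n_gt0 Qn).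
by rewrite (@eq_cpow _ _ _ 0) ?cpow0 // mulrC -[N%:Z]mulr1 F_N.
Qed.

(** R is Q^(d c) with c prime to N, and Q^d has order dividing N; so R and Q^d
    are powers of each other. *)
Let R_Qd : eqm D R ((Q ^+ d) ^+ `|(c %% N)%Z|).
Proof.
rewrite R_t /= mul1r -exprM -(cpow_nat Qn).
rewrite (@eq_cpow _ _ _ (d * `|(c %% N)%Z|)%N%:Z) //.
rewrite F_c PoszM gez0_abs ?modz_ge0 -?lt0n //.
rewrite eqm_dvd nE -mulrBr dvdz_mul2l -?lt0n // -eqm_dvd.
by rewrite eqm_modz.
Qed.

Let Qd_R : exists k : nat, eqm D (Q ^+ d) (R ^+ k).
Proof.
have [[x y] /= xy] := coprimezP _ _ c_N.
exists `|(x %% N)%Z|%N; rewrite R_t -(cpow_nat Qn) /= mul1r -(cpowMn n_gt0 Qn).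
rewrite (@eq_cpow _ _ d (f * Abar * `|(x %% N)%Z|%N%:Z)) //.
rewrite F_c gez0_abs ?modz_ge0 -?lt0n // -mulrA -{1}[d%:Z]mulr1 nE.
rewrite eqm_dvd -mulrBr dvdz_mul2l -?lt0n // -eqm_dvd eqm_modz.
by rewrite -xy addrC eqm_MDl mulrC.
Qed.

(** T divides M = T (W / N), and Q^d = (s / r)^d = 1 modulo T, whence R = 1.
    Conversely, modulo (M, R - 1) the unit Q^d is a power of R = 1, so that
    r^d = s^d. *)
Let gcd_T : gcdz M (R - 1) = `|T|%N.
Proof.
have Qd1 : eqm T (Q ^+ d) 1.
  have sr : eqm T (s ^+ d) (r%:Z ^+ d).
    by rewrite eqm_dvd dvdzE -abszN opprB.
  rewrite exprMn sr -exprMn.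
  by rewrite (eqm_dvdl T_dvd_D rhatP) expr1n.
congr Posz; apply/eqP; rewrite eqn_dvd; apply/andP; split; last first.
  rewrite dvdn_gcd; apply/andP; split; first by rewrite -dvdzE M_TW dvdz_mulr.
  rewrite -dvdzE -eqm_dvd (eqm_dvdl T_dvd_D R_Qd).
  by rewrite Qd1 expr1n.
pose g := gcdz M (R - 1).
have gD : (g %| D)%Z by apply: dvdz_trans M_dvd_D; exact: dvdz_gcdl.
have R1 : eqm g R 1 by rewrite eqm_dvd dvdz_gcdr.
have Qd1' : eqm g (Q ^+ d) 1.
  by have [k /(eqm_dvdl gD) ->] := Qd_R; rewrite R1 expr1n.
rewrite -[gcdn _ _]/(`|g|%N) -dvdzE -eqm_dvd.
have sE : eqm g s (r%:Z * Q).
  by rewrite mulrCA (eqm_dvdl gD rhatP) mulr1.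
by rewrite sE exprMn Qd1' mulr1.
Qed.

(** The gcd is positive and T may be negative: sg is the sign of T. *)
Let sg : int := (-1) ^+ (T < 0)%R.
Let u : int := sg * rhat ^+ (d * N.-1).
Let v : int := sg * r%:Z ^+ (d * N.-1).
Let e : int := (1 * M %/ gcdz M (R - 1))%Z.

Let sg2 : sg * sg = 1.
Proof. by rewrite -expr2 sqrr_sign. Qed.

Let uv : eqm D (u * v) 1.
Proof.
by rewrite mulrACA sg2 mul1r -exprMn [rhat * _]mulrC rhatP expr1n.
Qed.

Let eE : e = sg * (W %/ N)%Z.
Proof. by rewrite /e mul1r gcd_T divz_abs M_TW mulKz. Qed.

(** Both sides are rhat^(d(N-1)) W modulo D: on the left, the powers of
    R = Q^(d c) are those of Q^d in another order, and
    W = sum of r^(d(N-1-i)) s^(d i). *)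
Let sum_N : eqm D (\sum_(i < N) t 1 ^+ i) (N%:Z * u * e).
Proof.
have -> : N%:Z * u * e = rhat ^+ (d * N.-1) * W.
  rewrite eE /u -[in RHS](divzK N_dvd_W) -[RHS]mul1r -sg2.
  by ring.
rewrite mulr_sumr.
transitivity (\sum_(i < N) cpow n Q (d%:Z * (c * i%:Z))).
  apply: eqm_sum => i; rewrite /= mul1r -(cpowMn n_gt0 Qn).
  by rewrite F_c -mulrA.
rewrite (eqm_sum_perm (u := fun z => cpow n Q (d%:Z * z)) c_N); last first.
  move=> z w zw; apply: eq_cpow.
  by rewrite nE eqm_dvd -mulrBr dvdz_mul2l -?lt0n // -eqm_dvd.
apply: eqm_sum => i; rewrite -PoszM (cpow_nat Qn).
have iN : (i <= N.-1)%N by rewrite -ltnS prednK.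
rewrite -{1}(subnK iN) mulnDr exprD !exprM.
rewrite mulrACA -!exprMn [rhat * r%:Z]mulrC rhatP !expr1n mul1r.
by rewrite [rhat * s]mulrC.
Qed.

Let m_D x y : eqm (tw_mod t) x y <-> eqm D x y.
Proof. exact: eqm_abs. Qed.

Let m_NM : (tw_mod t)%:Z = `|N%:Z * M|.
Proof. by rewrite -D_NM -abszE. Qed.

Lemma classM_groupB : isomorphic (groupB M N R 1) (twisted t).
Proof.
apply: (groupB_twisted (e := e) (u := u) (v := v)) => //.
- exact/m_D.
- exact/m_D.
- exact/m_D.
Qed.

Lemma classM_metacyclic : metacyclic [set: twisted t].
Proof.
apply: (twisted_metacyclic (M := M) (N := N) (R := R) (u := u) (v := v)) => //.
- exact/m_D.
- exact/m_D.
Qed.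

End Arithmetic.

(** * The isomorphism type *)

Theorem corollary5 (r n : nat) (s f A : int) (n_gt0 : (0 < n)%N)
    (f_rs : (f * (r%:Z - s) = 0 %[mod n])%Z)
    (r_s : gcdz r s = 1) (n_A : gcdz n A = 1)
    (mu_neq0 : `|r%:Z ^+ n - s ^+ n| != 0)
    (rhat Abar : int)
    (rhatP : (r%:Z * rhat = 1 %[mod `|r%:Z ^+ n - s ^+ n|])%Z)
    (AbarP : (A * Abar = 1 %[mod n])%Z) :
  let mu : int := `|r%:Z ^+ n - s ^+ n| in
  let G : groupType := classM_group n_gt0 r s f A in
  let M : int := (gcdz n f * (r%:Z ^+ n - s ^+ n) %/ n)%Z in
  let N : int := (n %/ gcdz n f)%Z in
  let R : int := expz_mod mu (s * rhat) (f * Abar) in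
  [/\ (* M is an integer and the parameters of B are admissible *)
      (n %| gcdz n f * (r%:Z ^+ n - s ^+ n))%Z /\
        (R ^+ `|N|%N = 1 %[mod M])%Z,
      isomorphic G (groupB M N R 1)
    & exists gT : finGroupType,
        [/\ isomorphic G gT, metacyclic [set: gT] & #|gT| = mu :> int]].
Proof.
move: rhatP; rewrite -abszE => /eqm_abs rhatD mu G M N R.
have f_rs' : eqm n (f * r%:Z) (f * s).
  by rewrite eqm_dvd -mulrBr; apply/eqm0.
have D_neq0 : r%:Z ^+ n - s ^+ n != 0 by rewrite -normr_eq0.
have gE : gcdz n f = gcdn n `|f| by [].
have NE : N = (n %/ gcdn n `|f|)%N by rewrite /N gE divz_nat.
have R_t : eqm (r%:Z ^+ n - s ^+ n) R
                 (classM_twist Abar n_gt0 f_rs' D_neq0 rhatD 1).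
  rewrite -eqm_abs abszE /R /= mul1r.
  have Qn : eqm mu ((s * rhat) ^+ n) 1 by exact: (classM_Q_order rhatD).
  apply: (expz_mod_cpow n_gt0 Qn).
  by apply: (@coprimez_eqm _ _ ((s * rhat) ^+ n.-1)); rewrite -exprS prednK.
have G_t := classM_twisted n_gt0 f_rs' D_neq0 rhatD AbarP.
split.
- split; first exact: (classM_M_integral n_gt0 f_rs').
  rewrite NE; exact: (classM_R_admissible R_t).
- apply: (isomorphic_trans G_t); apply: isomorphic_sym.
  rewrite NE; exact: (classM_groupB AbarP R_t).
exists (twisted (classM_twist Abar n_gt0 f_rs' D_neq0 rhatD)); split.
- exact: G_t.
- exact: (classM_metacyclic R_t).
- by rewrite card_twisted /=.
Qed.
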